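(* For any finite group $G$ we have $$\mathsf{dcd}^*(G)\le\mathsf{dcd}(G)\le\mathsf{GD}(G)-1\le\mathsf{D}(G)-1.$$
   Context: For a finite group $G$, $\mathcal{F}(G)$ is the free abelian monoid with basis $G$, with operation $\cdot$; its elements are called sequences over $G$ (finite multisets of elements of $G$). For $S=g_1\cdot\ldots\cdot g_\ell\in\mathcal{F}(G)$, $|S|=\ell$ is the length, $\mathrm{supp}(S)=\{g_1,\dots,g_\ell\}$, and for $g\in\mathrm{supp}(S)$, $S\cdot g^{[-1]}$ denotes the sequence obtained from $S$ by removing one occurrence of $g$. $S$ is a product-one sequence if for some permutation $\pi$ of $\{1,\dots,\ell\}$ we have $g_{\pi(1)}\cdots g_{\pi(\ell)}=1_G$ in $G$; these form a submonoid $\mathcal{B}(G)$ of $\mathcal{F}(G)$. An element $S\in\mathcal{B}(G)$ is an atom if it cannot be written as $S=T\cdot U$ with $T,U\in\mathcal{B}(G)$, $|T|>0$, $|U|>0$. The large Davenport constant $\mathsf{D}(G)$ is the maximal length of an atom in $\mathcal{B}(G)$. For $B\subseteq G$ and $g\in\langle B\rangle$ (the subgroup generated by $B$), $\ell_B(g)$ is the minimal $n\in\mathbb{Z}_{\ge 0}$ such that $g$ is a product of $n$ (not necessarily distinct) elements of $B$ ($\ell_B(1_G)=0$). The directed Cayley diameter is $\mathsf{dcd}(G):=\max\{\ell_B(g)\mid g\in G,\ B\subseteq G,\ \langle B\rangle=G\}$. An element $S\in\mathcal{B}(G)$ is a directed geodesic atom if there exists $g\in\mathrm{supp}(S)$ such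 that $\ell_{\mathrm{supp}(S\cdot g^{[-1]})}(g^{-1})=|S|-1$; $\mathcal{GA}(G)$ is the set of directed geodesic atoms. Set $\mathsf{GD}(G):=\max\{|S| : S\in\mathcal{GA}(G)\}$ and $\mathsf{dcd}^*(G):=\max\{|S| : S\in\mathcal{GA}(G),\ \langle\mathrm{supp}(S)\rangle=G\}-1$. *)

(* Defs.v *)
From mathcomp Require Import all_boot all_fingroup.
From mathcomp Require Import finmap multiset.
From mathcomp Require Import boolp.

Set Implicit Arguments.
Unset Strict Implicit.
Unset Printing Implicit Defensive.

Local Open Scope group_scope.
Local Open Scope nat_scope.
Local Open Scope mset_scope.

Section Words.
Variable gT : finGroupType.
Implicit Types (B : {set gT}) (g x : gT) (s : seq gT) (n : nat).

(* [B ^+ n] is the n-fold product set in the monoid of subsets of gT.         *)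
Lemma expsetP B n g :
  g \in (B ^+ n)%g <->
  exists s, [/\ size s = n, {subset s <= B} & g = (\prod_(x <- s) x)%g].
Proof.
split=> [|[s [<- sB ->]]].
  elim: n g => [|n IHn] g.
    by rewrite expg0 => /set1P ->; exists [::]; rewrite big_nil.
  rewrite expgS => /mulsgP[b h Bb /IHn[s [<- sB ->]] ->].
  exists (b :: s); rewrite big_cons; split=> // x.
  by rewrite inE => /predU1P[->|/sB].
elim: s sB => [|b s IHs] sB; first by rewrite big_nil set11.
rewrite big_cons expgS mem_mulg ?sB ?mem_head //.
by apply: IHs => x xs; rewrite sB // inE xs orbT.
Qed.

Lemma prod_seq_gen B s : {subset s <= B} -> (\prod_(x <- s) x)%g \in <<B>>.
Proof.
by move=> sB; rewrite big_seq; apply: group_prod => x /sB Bx; rewrite mem_gen.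
Qed.

Lemma pigeonhole_word s : #|gT| < size s ->
  exists s1 s2 s3, [/\ s = s1 ++ s2 ++ s3, 0 < size s2, size s2 < size s &
                       (\prod_(x <- s2) x)%g = 1%g].
Proof.
move=> lt_s; pose f (i : 'I_(size s)) := (\prod_(x <- take i s) x)%g.
have /injectivePn[i0 [j0 ne_ij f_ij]] : ~~ injectiveb f.
  apply/negP => /injectiveP/leq_card; rewrite card_ord.
  by rewrite leqNgt lt_s.
wlog lt_ij : i0 j0 ne_ij f_ij / i0 < j0.
  move=> IH; move: (ne_ij); rewrite -val_eqE neq_ltn => /orP[]; first exact: IH.
  by apply: IH; rewrite // eq_sym.
case: i0 j0 => [i i_lt] [j j_lt] /= in ne_ij f_ij lt_ij.
have szj : size (take j s) = j by rewrite size_take j_lt.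
exists (take i s), (drop i (take j s)), (drop j s).
have def_t : take j s = take i s ++ drop i (take j s).
  by rewrite -{1}(cat_take_drop i (take j s)) take_takel // ltnW.
split.
- by rewrite catA -def_t cat_take_drop.
- by rewrite size_drop szj subn_gt0.
- by rewrite size_drop szj (leq_ltn_trans (leq_subr _ _)).
- apply: (mulgI (\prod_(x <- take i s) x)%g).
  by rewrite -big_cat -def_t mulg1; apply/esym.
Qed.

Lemma mem_gen_expset B g : g \in <<B>> -> exists n, g \in (B ^+ n)%g.
Proof.
case/gen_prodgP=> n [c Bc ->]; exists n; apply/expsetP.
exists [seq c i | i <- index_enum 'I_n]; split.
- by rewrite size_map -[index_enum _]enumT size_enum_ord.
- by move=> x /mapP[i _ ->].
- by rewrite big_map.
Qed.

(* Only meaningful for g \in <<B>>; set to 0 otherwise.                       *)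
Definition ell B g : nat :=
  if @idP (g \in <<B>>) is ReflectT Bg then ex_minn (mem_gen_expset Bg) else 0.

Lemma ellP B g : g \in <<B>> ->
  g \in (B ^+ ell B g)%g /\ forall n, g \in (B ^+ n)%g -> ell B g <= n.
Proof. by rewrite /ell; case: {-}_ / idP => // Bg _; case: ex_minnP. Qed.

End Words.

Definition dcd (gT : finGroupType) (G : {group gT}) : nat :=
  \max_(B : {set gT} | <<B>> == G) \max_(g in G) ell B g.

Section Sequences.
Variables (gT : finGroupType) (G : {group gT}).
Implicit Types (S T U : {mset gT}) (g : gT) (n : nat) (P : {mset gT} -> Prop).

Definition supp S : {set gT} := [set x in S].

(* S \in B(G): S has all its terms in G, and some ordering of its terms has   *)
(* product 1.                                                                 *)
Definition product_one S : Prop :=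
  supp S \subset G /\
  exists2 s : seq gT, perm_eq s S & (\prod_(x <- s) x)%g = 1%g.

(* The empty sequence satisfies this condition as well; this does not affect  *)
(* the maximal length of an atom, as [mset 1] is always an atom.              *)
Definition atom S : Prop :=
  product_one S /\
  ~ exists T U, [/\ product_one T, product_one U,
                    0 < size T, 0 < size U & S = T `+` U].

(* supp S is nonempty here, so the truncated predecessor is |S| - 1.         *)
Definition geodesic_atom S : Prop :=
  product_one S /\
  exists2 g, g \in supp S & ell (supp (S `\ g)) g^-1%g = (size S).-1.

Definition generating_geodesic_atom S : Prop :=
  geodesic_atom S /\ <<supp S>> = G.

Definition has_length P n : bool := `[< exists2 S, P S & size S = n >].

Lemma has_lengthP P n :
  reflect (exists2 S, P S & size S = n) (has_length P n).
Proof. exact: asboolP. Qed.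

Lemma in_supp S g : (g \in supp S) = (g \in S). Proof. by rewrite inE. Qed.

Lemma size_seq_mset (s : seq gT) : size (seq_mset s) = size s.
Proof. exact/perm_size/perm_eq_seq_mset. Qed.

Lemma supp_seq_mset (s : seq gT) : supp (seq_mset s) = [set x in s].
Proof. by apply/setP=> x; rewrite !inE (perm_mem (perm_eq_seq_mset s)). Qed.

Lemma seq_mset_cat (s t : seq gT) :
  seq_mset (s ++ t) = seq_mset s `+` seq_mset t.
Proof.
by apply/msetP => x; rewrite msetE2 !mset_seqE count_cat.
Qed.

Lemma perm_seq_mset (s : seq gT) S : perm_eq s S -> S = seq_mset s.
Proof. by move=> sS; rewrite -[LHS]seq_mset_id; apply/eq_seq_msetP; rewrite perm_sym. Qed.

Lemma product_one_seq (s : seq gT) :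
  {subset s <= G} -> (\prod_(x <- s) x)%g = 1%g -> product_one (seq_mset s).
Proof.
move=> sG s1; split.
  by rewrite supp_seq_mset; apply/subsetP => x; rewrite inE => /sG.
by exists s => //; rewrite perm_sym perm_eq_seq_mset.
Qed.

Lemma atom_length_ex : exists n, has_length atom n.
Proof.
exists 0; apply/has_lengthP; exists (seq_mset [::]); last exact: size_seq_mset.
split; first by apply: product_one_seq; rewrite ?big_nil.
case=> T [U [_ _ T0 _ /(congr1 (fun S => size S))]].
move/eqP; rewrite size_seq_mset /= eq_sym size_mset_eq0 => /eqP/msetP TU.
move: T0; rewrite lt0n size_mset_eq0 => /eqP[]; apply/msetP => x.
by move: (TU x); rewrite msetE2 !mset0E => /eqP; rewrite addn_eq0 => /andP[/eqP].
Qed.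

Lemma atom_length_bound n : has_length atom n -> n <= #|gT|.
Proof.
case/has_lengthP => S [[suppS [s sS s1]] atomS] <-.
rewrite leqNgt; apply/negP => ltGS; apply: atomS.
rewrite -(perm_size sS) in ltGS.
have sG : {subset s <= G}.
  by move=> x xs; apply: (subsetP suppS); rewrite in_supp -(perm_mem sS).
have [s1' [s2 [s3 [def_s s2_0 lt_s2 s2_1]]]] := pigeonhole_word ltGS.
have subG (t : seq gT) : {subset t <= s} -> {subset t <= G} by move=> ts x /ts/sG.
exists (seq_mset s2), (seq_mset (s1' ++ s3)); split.
- apply: product_one_seq => //; apply: subG => x x2.
  by rewrite def_s !mem_cat x2 orbT.
- apply: product_one_seq.
    by apply: subG => x; rewrite def_s !mem_cat => /orP[] ->; rewrite ?orbT.
  by move: s1; rewrite def_s !big_cat /= s2_1 mul1g.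
- by rewrite size_seq_mset.
- rewrite size_seq_mset; move: lt_s2; rewrite def_s !size_cat addnCA.
  by rewrite -[ltnLHS]addn0 ltn_add2l.
- rewrite (perm_seq_mset sS) -seq_mset_cat; apply/eq_seq_msetP.
  by rewrite def_s perm_catCA.
Qed.

Lemma generating_geodesic_atom_ex : exists S, generating_geodesic_atom S.
Proof.
have [B minB _] := @minset_exists _ (fun B : {set gT} => <<B>> == G) G (introT eqP (genGid G)).
case/minsetP: minB => /eqP genB minB.
set w := enum B; set p := (\prod_(x <- w) x)%g.
have wB x : (x \in w) = (x \in B) by rewrite mem_enum.
have Bp : p \in <<B>> by apply: prod_seq_gen => x; rewrite wB.
have BG : {subset B <= G} by move=> x Bx; rewrite -genB mem_gen.
have defS : seq_mset (p^-1%g :: w) = p^-1%g +` seq_mset w by exact: mset_cons.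
have suppw : supp (seq_mset w) = B.
  by rewrite supp_seq_mset; apply/setP => x; rewrite inE wB.
have Gp : p^-1%g \in G by rewrite groupV -genB.
exists (seq_mset (p^-1%g :: w)); split; last first.
  rewrite supp_seq_mset; apply/eqP; rewrite eqEsubset gen_subG; apply/andP; split.
    by apply/subsetP => x; rewrite !inE wB => /predU1P[->|/BG].
  rewrite -{1}genB genS //; apply/subsetP => x Bx.
  by rewrite !inE wB Bx orbT.
split.
  apply: product_one_seq; last by rewrite big_cons mulVg.
  by move=> x; rewrite inE wB => /predU1P[->|/BG].
exists p^-1%g; first by rewrite supp_seq_mset !inE eqxx.
rewrite size_seq_mset defS msetD1K suppw invgK /= -cardE.
have [ell_p min_p] := ellP Bp.
apply/eqP; rewrite eqn_leq min_p /=; last first.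
  by apply/expsetP; exists w; split=> [|x|//]; rewrite ?cardE ?wB.
case/expsetP: ell_p => t [<- tB def_p]; rewrite leqNgt; apply/negP => lt_tB.
have /subsetPn[b Bb t'b] : ~~ (B \subset t).
  apply/negP => /subset_leq_card le_Bt; have := card_size t.
  by rewrite leqNgt (leq_trans lt_tB).
have wb : b \in w by rewrite wB.
have gen_sub u : {subset u <= B} -> b \notin u -> (\prod_(x <- u) x)%g \in <<B :\ b>>.
  move=> uB u'b; apply: prod_seq_gen => x ux; rewrite !inE uB // andbT.
  by apply: contraNneq u'b => <-.
have p' : p \in <<B :\ b>> by rewrite def_p gen_sub.
have uw : uniq w by exact: enum_uniq.
have [w1 [w2 def_w]] : exists w1 w2, w = w1 ++ b :: w2.
  by case/splitPr: wb => w1 w2; exists w1, w2.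
move: uw; rewrite def_w cat_uniq /= negb_or => /and3P[_ /andP[w1'b _] /andP[w2'b _]].
have w1B : {subset w1 <= B} by move=> x; rewrite -wB def_w mem_cat => ->.
have w2B : {subset w2 <= B}.
  by move=> x; rewrite -wB def_w mem_cat inE => ->; rewrite !orbT.
move: p'; rewrite /p def_w big_cat big_cons /= groupMl ?gen_sub // groupMr ?gen_sub //.
move=> genb; have genB' : <<B :\ b>> = G.
  apply/eqP; rewrite eqEsubset; apply/andP; split.
    by rewrite -genB genS ?subD1set.
  rewrite -genB gen_subG.
  apply/subsetP => x Bx; have [-> //|ne_xb] := eqVneq x b.
  by rewrite mem_gen // !inE ne_xb.
have := minB (B :\ b); rewrite genB' eqxx subD1set => /(_ isT isT) defB.
by move: Bb; rewrite -defB !inE eqxx.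
Qed.

Lemma generating_geodesic_atom_length_ex :
  exists n, has_length generating_geodesic_atom n.
Proof.
have [S gaS] := generating_geodesic_atom_ex.
by exists (size S); apply/has_lengthP; exists S.
Qed.

Lemma geodesic_atom_length_ex : exists n, has_length geodesic_atom n.
Proof.
have [S [gaS _]] := generating_geodesic_atom_ex.
by exists (size S); apply/has_lengthP; exists S.
Qed.

Let ell_max := \max_(B : {set gT}) \max_(g : gT) ell B g.

Lemma geodesic_atom_length_bound n :
  has_length geodesic_atom n -> n <= ell_max.+1.
Proof.
case/has_lengthP => S [_ [g _ ell_g]] <-.
apply: leq_trans (leqSpred _) _; rewrite ltnS -ell_g.
exact: leq_trans (leq_bigmax (F := ell _) g^-1%g) (leq_bigmax _).
Qed.

Lemma generating_geodesic_atom_length_bound n :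
  has_length generating_geodesic_atom n -> n <= ell_max.+1.
Proof.
case/has_lengthP => S [gaS _] <-.
by apply: geodesic_atom_length_bound; apply/has_lengthP; exists S.
Qed.

Definition large_davenport : nat :=
  ex_maxn (P := has_length atom) atom_length_ex atom_length_bound.

Definition GD : nat :=
  ex_maxn (P := has_length geodesic_atom)
    geodesic_atom_length_ex geodesic_atom_length_bound.

(* Geodesic atoms are nonempty, so the predecessor does not truncate.         *)
Definition dcd_star : nat :=
  (ex_maxn (P := has_length generating_geodesic_atom)
    generating_geodesic_atom_length_ex
    generating_geodesic_atom_length_bound).-1.

End Sequences.

(* Main.v *)
(** Rotating an ordering of a product-one sequence S so that a given term g comes
    first shows that g^-1 is a product of the remaining |S| - 1 terms. A
    factorization of a geodesic atom would thus write g^-1 with too few factors,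
    and a geodesic expression of g over a generating set B becomes a geodesic
    atom by adding the term g^-1. *)

Require Import Defs.
From mathcomp Require Import all_boot all_fingroup.
From mathcomp Require Import finmap multiset.

Set Implicit Arguments.
Unset Strict Implicit.
Unset Printing Implicit Defensive.

Local Open Scope nat_scope.
Local Open Scope mset_scope.

Section Words.
Variable gT : finGroupType.
Implicit Types (B C : {set gT}) (g : gT) (s : seq gT).

Lemma ell_prod_le B s : {subset s <= B} -> ell B (\prod_(x <- s) x)%g <= size s.
Proof.
move=> sB; have [_ -> //] := ellP (prod_seq_gen sB).
by apply/expsetP; exists s.
Qed.

Lemma ell_word B g : g \in <<B>>%g ->
  exists s, [/\ size s = ell B g, {subset s <= B} & g = (\prod_(x <- s) x)%g].
Proof. by case/ellP=> /expsetP. Qed.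

(** A shortest word over [C] is also a word over [B]. Membership in [<<C>>] excludes the default
    value 0 of [ell C g]. *)
Lemma ell_anti B C g : C \subset B -> g \in <<C>>%g -> ell B g <= ell C g.
Proof.
move=> /subsetP sCB /ell_word[s [<- sC ->]].
by apply: ell_prod_le => x /sC/sCB.
Qed.

End Words.

Section GeodesicAtoms.
Variables (gT : finGroupType) (G : {group gT}).
Implicit Types (S T U : {mset gT}) (g : gT) (s : seq gT) (B : {set gT}).

Lemma supp_seq_msetD1 g s :
  supp (seq_mset (g :: s) `\ g) = [set x in s].
Proof. by rewrite mset_cons msetD1K supp_seq_mset. Qed.

Lemma product_one_word S g : product_one G S -> g \in S ->
  exists2 s, S = seq_mset (g :: s) & g^-1%g = (\prod_(x <- s) x)%g.
Proof.
case=> _ [t tS t1] Sg; have gt: g \in t by rewrite (perm_mem tS).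
case/splitPr: gt tS t1 => t1' t2 tS t1.
(* Cyclic rotation: [t1' g t2 = 1] is conjugate to [g t2 t1' = 1]. *)
exists (t2 ++ t1').
  rewrite (perm_seq_mset tS); apply/eq_seq_msetP.
  by rewrite perm_catC.
move/eqP: t1; rewrite !big_cat big_cons /= -eq_invg_mul => /eqP t1'_inv.
by apply/eqP; rewrite eq_invg_mul mulgA -t1'_inv mulVg.
Qed.

Lemma geodesic_atom_atom S : geodesic_atom G S -> atom G S.
Proof.
case=> S1 [g]; rewrite in_supp => Sg ellS; split=> //.
move=> [T [U [T1 U1 T0 U0 defS]]].
wlog Tg : T U T1 U1 T0 U0 defS / g \in T.
  move=> IH; move: (Sg); rewrite defS in_msetD => /orP[] gTU.
    exact: (IH T U).
  by apply: (IH U T) => //; rewrite msetDC.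
have [t defT def_g] := product_one_word T1 Tg.
have [u defU] : exists u, U = seq_mset u by exists (U : seq gT); rewrite seq_mset_id.
move: ellS U0; rewrite defS defT defU -seq_mset_cat cat_cons supp_seq_msetD1.
rewrite !size_seq_mset /= size_cat => ell_g u0.
(* The factor containing [g] already spells [g^-1] with the letters [t], and [u] is nonempty, so
   [size t] is below the geodesic length [size t + size u]. *)
have : ell [set x in t ++ u] g^-1%g <= size t.
  by rewrite def_g ell_prod_le // => x; rewrite inE mem_cat => ->.
by rewrite ell_g leqNgt -[ltnLHS]addn0 ltn_add2l u0.
Qed.

Lemma geodesic_word_atom B g : g \in G -> <<B>>%g = G ->
  exists2 S, geodesic_atom G S & size S = (ell B g).+1.
Proof.
move=> Gg genB; have Bg : g \in <<B>>%g by rewrite genB.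
have [s [szs sB def_g]] := ell_word Bg.
exists (seq_mset (g^-1%g :: s)); last by rewrite size_seq_mset /= szs.
split.
  apply: product_one_seq; last by rewrite big_cons -def_g mulVg.
  by move=> x /predU1P[->|/sB Bx]; rewrite ?groupV // -genB mem_gen.
exists g^-1%g; first by rewrite supp_seq_mset !inE eqxx.
have ss : {subset s <= [set x in s]} by move=> x; rewrite inE.
rewrite supp_seq_msetD1 invgK size_seq_mset /=; apply/eqP.
(* The word [s] bounds the length from above. From below, shrinking [B] to the letters of [s] cannot
   shorten expressions of [g]. *)
rewrite eqn_leq {1}def_g ell_prod_le // szs ell_anti //.
  by apply/subsetP=> x; rewrite inE => /sB.
by rewrite def_g prod_seq_gen.
Qed.

(** Removing [g] keeps the support generating, since [g^-1] is a product of the remaining terms;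
    hence the geodesic length of [g^-1] over them is among the values maximized in [dcd]. *)
Lemma generating_geodesic_atom_le_dcd S :
  generating_geodesic_atom G S -> (size S).-1 <= dcd G.
Proof.
case=> [[S1 [g]]]; rewrite in_supp => Sg <- suppG.
have [s defS def_g] := product_one_word S1 Sg.
have Gg : g^-1%g \in G by rewrite groupV -suppG mem_gen ?in_supp.
have defsupp : supp (S `\ g) = [set x in s] by rewrite defS supp_seq_msetD1.
have gen_s : <<supp (S `\ g)>>%g == G.
  rewrite defsupp -suppG defS supp_seq_mset eqEsubset; apply/andP; split.
    by rewrite genS //; apply/subsetP=> x; rewrite !inE orbC => ->.
  rewrite gen_subG; apply/subsetP=> x; rewrite !inE => /predU1P[->|xs].
    by rewrite -groupV def_g prod_seq_gen // => y; rewrite inE.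
  by rewrite mem_gen ?inE.
apply: (bigop.bigmax_sup (supp (S `\ g))) => //.
exact: (bigop.bigmax_sup g^-1%g).
Qed.

End GeodesicAtoms.

Theorem corollary5p6 (gT : finGroupType) (G : {group gT}) :
  [/\ dcd_star G <= dcd G,
      dcd G <= (GD G).-1 &
      (GD G).-1 <= (large_davenport G).-1].
Proof.
split.
- rewrite /dcd_star; case: ex_maxnP => _ /has_lengthP[S gaS <-] _.
  exact: generating_geodesic_atom_le_dcd.
- rewrite /GD; case: ex_maxnP => m _ max_m.
  apply/bigmax_leqP=> B /eqP genB; apply/bigmax_leqP=> g Gg.
  have [S gaS szS] := geodesic_word_atom Gg genB.
  have: size S <= m by apply: max_m; apply/has_lengthP; exists S.
  (* The bound [(ell B g).+1 <= m] forces [m] to be positive, so its predecessor does not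
     truncate. *)
  by rewrite szS; case: m {max_m}.
- rewrite /GD /large_davenport; case: ex_maxnP => _ /has_lengthP[S gaS <-] _.
  case: ex_maxnP => m _ max_m; rewrite -!subn1 leq_sub2r //.
  by apply: max_m; apply/has_lengthP; exists S; first exact: geodesic_atom_atom.
Qed.
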